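(* Let $f : \mathbb{R}^n \to \mathbb{R}$ be a function which is $1$-smooth with respect to the norm $\|\cdot\|_B$, where $B$ is an $n\times n$ real symmetric positive definite matrix, let $1\leq\tau\leq n$, and let $f$ be strongly convex with respect to the norm $\|\cdot\|_{B_\tau}$ with modulus $\mu_\tau$. Let $x_0$ be a deterministic point in $\mathbb{R}^n$, let $K\geq 1$, and let $(x_k)_{k=1}^K$ be the random points in $\mathbb{R}^n$ generated by $\mathrm{RCDVS}(f,B,\tau,x_0,K)$. Then $$\mathbb{E} f(x_k) - \min f \leq (1-\mu_\tau)^k\,(f(x_0)-\min f)$$ for all $0\leq k\leq K$.
   Context: Notation: $\langle\cdot,\cdot\rangle$ is the standard inner product on $\mathbb{R}^n$; for a symmetric positive semidefinite matrix $B$, $\|v\|_B := \langle Bv, v\rangle^{1/2}$. A differentiable function $f:\mathbb{R}^n\to\mathbb{R}$ is $1$-smooth with respect to $\|\cdot\|_B$ if $f(y) \leq f(x) + \langle \nabla f(x), y-x\rangle + \frac12\|y-x\|_B^2$ for all $x,y\in\mathbb{R}^n$. $\tau$-coordinate approximation: if $\lambda_1\ge\dots\ge\lambda_n$ are the eigenvalues of $B$ and $B = Q\operatorname{Diag}(\lambda_1,\dots,\lambda_n)Q^T$ with $Q$ orthogonal, then for $1\le\tau\le\operatorname{Rank}(B)$, $B_\tau := Q\operatorname{Diag}(\lambda_1,\dots,\lambda_\tau,\lambda_\tau,\dots,\lambda_\tau)Q^T + \left(\sum_{i=\tau+1}^n\lambda_i\right) I$. It is positive definite and does not depend on the choice of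 $Q$. A differentiable function $f$ is strongly convex with respect to $\|\cdot\|_{B_\tau}$ if there is $\mu_\tau>0$ such that $f(y)\geq f(x)+\langle\nabla f(x),y-x\rangle+\frac{\mu_\tau}{2}\|y-x\|_{B_\tau}^2$ for all $x,y\in\mathbb{R}^n$; the largest such $\mu_\tau$ is called the modulus of strong convexity. $\binom{[n]}{\tau}$ is the collection of all $\tau$-element subsets of $[n]=\{1,\dots,n\}$. For $S \in \binom{[n]}{\tau}$, $I_S$ is the $n\times\tau$ matrix obtained from the $n\times n$ identity matrix $I$ by retaining only the columns with indices in $S$; $B_{S\times S} := I_S^T B I_S$; $v_S := I_S^T v$ for $v\in\mathbb{R}^n$. Volume sampling: for $1\le\tau\le\operatorname{Rank}(B)$, a random variable $S_0$ with values in $\binom{[n]}{\tau}$ satisfies $S_0\sim\mathrm{Vol}_\tau(B)$ if $\mathbb{P}(S_0=S) = \det(B_{S\times S}) / \sum_{S'\in\binom{[n]}{\tau}} \det(B_{S'\times S'})$ for all $S\in\binom{[n]}{\tau}$. $\mathrm{RCDVS}(f,B,\tau,x_0,K)$: for $k=0,\dots,K-1$, choose $S_k\sim\mathrm{Vol}_\tau(B)$ (independently of the previous choices) and set $x_{k+1} := x_k - I_{S_k}(B_{S_k\times S_k})^{-1}\nabla f(x_k)_{S_k}$. *)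

(* Defs.v *)
From HB Require Import structures.
From mathcomp Require Import all_boot all_order all_algebra.
From mathcomp Require Import all_classical all_reals all_analysis.
Set Implicit Arguments.
Unset Strict Implicit.
Unset Printing Implicit Defensive.
Import Order.TTheory GRing.Theory Num.Theory.
Import numFieldNormedType.Exports.
Local Open Scope classical_set_scope.
Local Open Scope ring_scope.

Definition inner (R : realType) (n : nat) (u v : 'cV[R]_n) : R :=
  \sum_(i < n) u i 0 * v i 0.

Definition normB (R : realType) (n : nat) (B : 'M[R]_n) (v : 'cV[R]_n) : R :=
  Num.sqrt (inner (B *m v) v).

Definition pos_def (R : realType) (n : nat) (B : 'M[R]_n) : Prop :=
  B^T = B /\ forall v : 'cV[R]_n, v != 0 -> 0 < inner (B *m v) v.

Definition grad (R : realType) (n : nat) (f : 'cV[R]_n -> R) (x : 'cV[R]_n) :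
    'cV[R]_n :=
  \col_(i < n) 'D_(delta_mx i 0) f x.

Definition one_smooth (R : realType) (n : nat) (f : 'cV[R]_n -> R)
    (B : 'M[R]_n) : Prop :=
  (forall x, differentiable f x) /\
  forall x y, f y <= f x + inner (grad f x) (y - x)
                     + 2^-1 * normB B (y - x) ^+ 2.

Definition strongly_convex (R : realType) (n : nat) (f : 'cV[R]_n -> R)
    (C : 'M[R]_n) (mu : R) : Prop :=
  [/\ 0 < mu,
      forall x, differentiable f x
    & forall x y, f x + inner (grad f x) (y - x)
                  + mu / 2 * normB C (y - x) ^+ 2 <= f y].

Definition strong_convexity_modulus (R : realType) (n : nat)
    (f : 'cV[R]_n -> R) (C : 'M[R]_n) (mu : R) : Prop :=
  strongly_convex f C mu /\ forall nu, strongly_convex f C nu -> nu <= mu.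

(* [C] is the tau-coordinate approximation of [B].  The tuple is indexed from 0:
   the i-th largest eigenvalue is [lam`_(i - 1)], so that [lam`_tau.-1] is
   lambda_tau, and the sum below runs over lambda_{tau+1}, ..., lambda_n.  The
   matrix [C] does not depend on the choice of [Q]. *)
Definition coord_approx (R : realType) (n : nat) (B : 'M[R]_n) (tau : nat)
    (C : 'M[R]_n) : Prop :=
  (1 <= tau <= \rank B)%N /\
  exists (Q : 'M[R]_n) (lam : n.-tuple R),
    [/\ Q *m Q^T = 1%:M,
        sorted (fun a b : R => b <= a) lam,
        B = Q *m diag_mx (\row_(i < n) lam`_i) *m Q^T
      & C = Q *m diag_mx (\row_(i < n) lam`_(minn i tau.-1)) *m Q^T
            + (\sum_(tau <= i < n) lam`_i)%:M].

(* The columns of the identity matrix with indices in [A], in increasing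
   order. *)
Definition colsel (R : realType) (n : nat) (A : {set 'I_n}) :
    'M[R]_(n, #|A|) :=
  colsub (fun j : 'I_#|A| => enum_val j) 1%:M.

Definition subm (R : realType) (n : nat) (B : 'M[R]_n) (A : {set 'I_n}) :
    'M[R]_#|A| :=
  (colsel R A)^T *m B *m colsel R A.

Definition subv (R : realType) (n : nat) (v : 'cV[R]_n) (A : {set 'I_n}) :
    'cV[R]_#|A| :=
  (colsel R A)^T *m v.

Definition vol_mass (R : realType) (n : nat) (B : 'M[R]_n) (tau : nat)
    (A : {set 'I_n}) : R :=
  \det (subm B A) / \sum_(A' : {set 'I_n} | #|A'| == tau) \det (subm B A').

Definition discrete_rv d (T : measurableType d) (X : finType) (S : T -> X) :
    Prop :=
  forall a : X, measurable (S @^-1` [set a]).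

Definition volume_sampled d (T : measurableType d) (R : realType)
    (P : probability T R) (n : nat) (B : 'M[R]_n) (tau : nat)
    (S : T -> {set 'I_n}) : Prop :=
  [/\ discrete_rv S,
      forall w, #|S w| = tau
    & forall A : {set 'I_n}, #|A| = tau ->
        P (S @^-1` [set A]) = (vol_mass B tau A)%:E].

Definition independent_rv d (T : measurableType d) (R : realType)
    (P : probability T R) (X Y : finType) (U : T -> X) (V : T -> Y) : Prop :=
  forall (A : set X) (A' : set Y),
    P (U @^-1` A `&` V @^-1` A') = (P (U @^-1` A) * P (V @^-1` A'))%E.

Definition rcd_step (R : realType) (n : nat) (f : 'cV[R]_n -> R)
    (B : 'M[R]_n) (A : {set 'I_n}) (x : 'cV[R]_n) : 'cV[R]_n :=
  x - colsel R A *m invmx (subm B A) *m subv (grad f x) A.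

(* [S] are the sampled coordinate sets (only S 0, ..., S (K - 1) matter) and
   [x] the random iterates (only x 0, ..., x K matter). *)
Definition RCDVS d (T : measurableType d) (R : realType) (P : probability T R)
    (n : nat) (f : 'cV[R]_n -> R) (B : 'M[R]_n) (tau : nat) (x0 : 'cV[R]_n)
    (K : nat) (S : nat -> T -> {set 'I_n}) (x : nat -> T -> 'cV[R]_n) : Prop :=
  (forall w, x 0%N w = x0) /\
  forall k, (k < K)%N ->
    [/\ volume_sampled P B tau (S k),
        independent_rv P (S k) (fun w => [ffun i : 'I_k => S i w])
      & forall w, x k.+1 w = rcd_step f B (S k w) (x k w)].

(* Main.v *)
(* Let B = Q Diag(l) Q^T, let g be a gradient and h = Q^T g.  Smoothness makes
   the step along A decrease f by at least <g_A, B_AA^-1 g_A> / 2.  The expected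
   value of <g_A, B_AA^-1 g_A> under volume sampling is computed by comparing
   the sums of the principal minors of order tau of B and of B + g g^T: by the
   matrix determinant lemma their difference is the sum of
   det(B_AA) <g_A, B_AA^-1 g_A>, and it is unchanged when (B, g) is replaced by
   (Diag(l), h), because the sum of the principal minors of order tau is a
   coefficient of det(1 + X B).  The expectation is therefore
   sum_i h_i^2 e_{tau-1}(l without l_i) / e_tau(l), and an elementary inequality
   between symmetric functions bounds it below by sum_i h_i^2 / b_i, where the
   b_i are the eigenvalues of B_tau.  Minimizing the strong convexity bound over
   y gives f(x) - min f <= (2 mu)^-1 sum_i h_i^2 / b_i, hence a contraction by
   1 - mu in conditional expectation. *)
Require Import Defs.
From HB Require Import structures.
From mathcomp Require Import all_boot all_order all_algebra.
From mathcomp Require Import all_classical all_reals all_analysis.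
From mathcomp Require Import perm zify ring lra.
Set Implicit Arguments.
Unset Strict Implicit.
Unset Printing Implicit Defensive.
Import Order.TTheory GRing.Theory Num.Theory.
Import numFieldNormedType.Exports.
Local Open Scope classical_set_scope.
Local Open Scope ring_scope.

(** * Determinant identities and sums of principal minors *)

(** The products of the block matrices [L] and [M], in either order, are block lower triangular,
    with [1 + U V] and [1 + V U] as the nontrivial diagonal blocks. *)
Lemma det_add1_mulmxC (R : comNzRingType) m n (U : 'M[R]_(m, n))
    (V : 'M[R]_(n, m)) :
  \det (1%:M + U *m V) = \det (1%:M + V *m U).
Proof.
pose L := block_mx (1%:M : 'M[R]_m) U 0 (1%:M : 'M[R]_n).
pose M := block_mx (1%:M : 'M[R]_m) (- U) V (1%:M : 'M[R]_n).
have : \det (L *m M) = \det (M *m L) by rewrite !det_mulmx mulrC.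
rewrite !mulmx_block !(mul1mx, mulmx1, mulmx0, mul0mx, addr0, add0r).
by rewrite addNr subrr !det_lblock !det1 mul1r mulr1 [V *m U + _]addrC.
Qed.

Lemma det_rank1_update (R : comUnitRingType) n (N : 'M[R]_n) (u v : 'cV[R]_n) :
  N \in unitmx ->
  \det (N + u *m v^T) = \det N * (1 + (v^T *m (invmx N *m u)) 0 0).
Proof.
move=> uN; have -> : N + u *m v^T = N *m (1%:M + (invmx N *m u) *m v^T).
  by rewrite mulmxDr mulmx1 -!mulmxA mulKVmx.
by rewrite det_mulmx det_add1_mulmxC det_mx11 !mxE eqxx.
Qed.

Lemma colsel_mul_tr (R : realType) n (A : {set 'I_n}) :
  colsel R A *m (colsel R A)^T = diag_mx (\row_i (i \in A)%:R).
Proof.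
apply/matrixP => i j; rewrite !mxE.
under eq_bigr do rewrite !mxE.
rewrite -(big_enum_val (fun a => (i == a)%:R * (j == a)%:R)) /=.
have [iA|iA] := boolP (i \in A).
  rewrite (bigD1 i) //= eqxx mul1r big1 ?addr0 1?eq_sym ?mulr1n // => a /andP[_].
  by rewrite eq_sym => /negbTE->; rewrite mul0r.
rewrite mul0rn big1 // => a aA; case: eqP => [ia|]; last by rewrite mul0r.
by rewrite ia aA in iA.
Qed.

Lemma tr_colsel_mul (R : realType) n (A : {set 'I_n}) :
  (colsel R A)^T *m colsel R A = 1%:M.
Proof.
apply/matrixP => i j; rewrite !mxE (bigD1 (enum_val i)) //= !mxE eqxx mul1r.
rewrite big1 ?addr0 => [|a ai]; first by rewrite (inj_eq enum_val_inj).
by rewrite !mxE (negbTE ai) mul0r.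
Qed.

(** As [C^T C = 1], [det_add1_mulmxC] turns the minor into the determinant of [1 + C C^T (B - 1)],
    whose size is independent of [A] and whose rows outside [A] are those of the identity. *)
Lemma det_subm (R : realType) n (B : 'M[R]_n) (A : {set 'I_n}) :
  \det (subm B A) = \det (\matrix_(i, j) if i \in A then B i j else (i == j)%:R).
Proof.
pose C := colsel R A.
have -> : subm B A = 1%:M + (C^T *m B - C^T) *m C.
  by rewrite mulmxBl tr_colsel_mul addrC subrK.
rewrite -det_add1_mulmxC mulmxBr mulmxA colsel_mul_tr; congr (\det _).
apply/matrixP => i j; rewrite mul_diag_mx !mxE.
by case: ifP => _; case: eqP => [->|]; 
  rewrite ?(mul1r, mul0r, subr0, addr0, add0r, mulr1n, mulr0n) // addrC ?subrK.
Qed.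

(** Each product in the Leibniz formula is expanded over the set [A] of rows where the [X] term is
    chosen; what belongs to one [A] is the Leibniz formula of the matrix in [det_subm]. *)
Lemma det_add1_polyX (R : realType) n (B : 'M[R]_n) :
  \det (1%:M + 'X *: map_mx polyC B) =
  \sum_(A : {set 'I_n}) \det (subm B A) *: 'X^#|A|.
Proof.
rewrite /determinant.
transitivity (\sum_(s : 'S_n) \sum_(A : {set 'I_n}) ((-1) ^+ s * \prod_i
    (if i \in A then B i (s i) else (i == s i)%:R)) *: 'X^#|A|).
  apply: eq_bigr => s _.
  under eq_bigr do rewrite !mxE addrC.
  rewrite bigA_distr big_distrr /=; apply: eq_bigr => A _.
  rewrite -mul_polyC polyCM rmorphXn rmorphN1 -mulrA; congr (_ * _).
  rewrite rmorph_prod /= (bigID (mem A)) /= [in RHS](bigID (mem A)) /=.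
  rewrite mulrAC; congr (_ * _).
    rewrite -prodr_const -big_split /=; apply: eq_bigr => i iA.
    by rewrite iA mulrC.
  by apply: eq_bigr => i /negbTE iA; rewrite iA rmorph_nat.
rewrite exchange_big; apply: eq_bigr => A _.
rewrite -[X in _ = X *: _]/(\det (subm B A)) det_subm -scaler_suml; 
congr (_ *: _).
by apply: eq_bigr => s _; congr (_ * _); apply: eq_bigr => i _; rewrite mxE.
Qed.

Lemma sum_minors_similar (R : realType) n (Q M : 'M[R]_n) k :
  Q *m Q^T = 1%:M ->
  \sum_(A : {set 'I_n} | #|A| == k) \det (subm (Q *m M *m Q^T) A) =
  \sum_(A : {set 'I_n} | #|A| == k) \det (subm M A).
Proof.
move=> QQ.
have coefE (N : 'M[R]_n) : \sum_(A : {set 'I_n} | #|A| == k) \det (subm N A) =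
    (\det (1%:M + 'X *: map_mx polyC N))`_k.
  rewrite det_add1_polyX coef_sum big_mkcond; apply: eq_bigr => A _.
  by rewrite coefZ coefXn eq_sym; case: eqP => _; rewrite ?mulr1 ?mulr0.
rewrite !coefE; congr (_`_k).
pose q := map_mx (polyC : R -> {poly R}) Q.
have qq : q *m q^T = 1%:M by rewrite map_trmx -map_mxM QQ map_mx1.
have -> : 1%:M + 'X *: map_mx polyC (Q *m M *m Q^T) =
    q *m (1%:M + 'X *: map_mx polyC M) *m q^T.
  by rewrite mulmxDr mulmx1 mulmxDl qq -scalemxAr -scalemxAl !map_mxM map_trmx.
by rewrite !det_mulmx mulrAC -det_mulmx qq det1 mul1r.
Qed.

(** * Inner products, positive definiteness and rank-one updates of minors *)

Lemma innerE (R : realType) n (u v : 'cV[R]_n) : inner u v = (u^T *m v) 0 0.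
Proof. by rewrite mxE; apply: eq_bigr => i _; rewrite mxE. Qed.

Lemma inner_mulmxl (R : realType) m n (C : 'M[R]_(m, n)) (u : 'cV[R]_n)
    (v : 'cV[R]_m) :
  inner (C *m u) v = inner u (C^T *m v).
Proof. by rewrite !innerE trmx_mul mulmxA. Qed.

Lemma innerC (R : realType) n (u v : 'cV[R]_n) : inner u v = inner v u.
Proof. by apply: eq_bigr => i _; rewrite mulrC. Qed.

Lemma inner_diag (R : realType) n (l : 'rV[R]_n) (v : 'cV[R]_n) :
  inner (diag_mx l *m v) v = \sum_i l 0 i * v i 0 ^+ 2.
Proof. by apply: eq_bigr => i _; rewrite mul_diag_mx mxE mulrA. Qed.

Lemma pos_def_unitmx (R : realType) n (B : 'M[R]_n) :
  pos_def B -> B \in unitmx.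
Proof.
move=> [Bsym Bpos]; rewrite unitmxE unitfE; apply/negP => /det0P[v v0 vB].
have := Bpos v^T; rewrite trmx_eq0 => /(_ v0).
by rewrite -{1}Bsym -trmx_mul vB trmx0 innerE trmx0 mul0mx mxE ltxx.
Qed.

Lemma pos_def_congr (R : realType) m n (B : 'M[R]_m) (C : 'M[R]_(m, n))
    (L : 'M[R]_(n, m)) :
  L *m C = 1%:M -> pos_def B -> pos_def (C^T *m B *m C).
Proof.
move=> LC [Bsym Bpos]; split; first by rewrite !trmx_mul trmxK Bsym mulmxA.
move=> v v0; rewrite -!mulmxA inner_mulmxl trmxK; apply: Bpos.
apply: contra v0 => /eqP Cv.
by rewrite -[v]mul1mx -LC -mulmxA Cv mulmx0.
Qed.

Lemma pos_def_subm (R : realType) n (B : 'M[R]_n) (A : {set 'I_n}) :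
  pos_def B -> pos_def (subm B A).
Proof. exact/pos_def_congr/tr_colsel_mul. Qed.

Lemma pos_def_diag (R : realType) n (l : 'rV[R]_n) (i : 'I_n) :
  pos_def (diag_mx l) -> 0 < l 0 i.
Proof.
move=> [_ /(_ (delta_mx i 0))]; rewrite inner_diag (bigD1 i) //= big1 => [|j].
  rewrite mxE !eqxx expr1n mulr1 addr0; apply; apply/eqP => /matrixP/(_ i 0).
  by rewrite !mxE !eqxx => /eqP; rewrite oner_eq0.
by move=> /negbTE ji; rewrite mxE ji expr0n mulr0.
Qed.

Lemma pos_def_conj_diag (R : realType) n (Q : 'M[R]_n) (l : 'rV[R]_n) :
  Q *m Q^T = 1%:M -> pos_def (Q *m diag_mx l *m Q^T) -> pos_def (diag_mx l).
Proof.
move=> /mulmx1C QQ /(pos_def_congr QQ).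
by rewrite -!mulmxA QQ mulmx1 mulmxA QQ mul1mx.
Qed.

(* Twice the guaranteed decrease of one coordinate step when [g] is the
   gradient. *)
Definition subm_quad (R : realType) n (B : 'M[R]_n) (A : {set 'I_n})
    (g : 'cV[R]_n) : R :=
  inner (subv g A) (invmx (subm B A) *m subv g A).

Lemma det_subm_rank1 (R : realType) n (B : 'M[R]_n) (A : {set 'I_n})
    (g : 'cV[R]_n) :
  pos_def B ->
  \det (subm (B + g *m g^T) A) =
  \det (subm B A) + \det (subm B A) * subm_quad B A g.
Proof.
move=> /(pos_def_subm A)/pos_def_unitmx uN.
have -> : subm (B + g *m g^T) A = subm B A + subv g A *m (subv g A)^T.
  by rewrite /subm /subv mulmxDr mulmxDl trmx_mul trmxK !mulmxA.
by rewrite det_rank1_update // mulrDr mulr1 /subm_quad innerE.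
Qed.

Lemma subm_diag (R : realType) n (l : 'rV[R]_n) (A : {set 'I_n}) :
  subm (diag_mx l) A = diag_mx (\row_(k < #|A|) l 0 (enum_val k)).
Proof.
apply/matrixP => i j; rewrite /subm -mulmxA mul_diag_mx !mxE.
rewrite (bigD1 (enum_val i)) //= !mxE eqxx mul1r big1 ?addr0 => [|a ai].
  by rewrite (inj_eq enum_val_inj) mulr_natr.
by rewrite !mxE (negbTE ai) mul0r.
Qed.

Lemma det_subm_diag (R : realType) n (l : 'rV[R]_n) (A : {set 'I_n}) :
  \det (subm (diag_mx l) A) = \prod_(i in A) l 0 i.
Proof.
rewrite subm_diag det_diag [RHS]big_enum_val /=.
by apply: eq_bigr => i _; rewrite mxE.
Qed.

Lemma subm_quad_diag (R : realType) n (l : 'rV[R]_n) (A : {set 'I_n})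
    (h : 'cV[R]_n) :
  pos_def (diag_mx l) ->
  subm_quad (diag_mx l) A h = \sum_(i in A) h i 0 ^+ 2 / l 0 i.
Proof.
move=> pD; have uN := pos_def_unitmx (pos_def_subm A pD).
pose L := diag_mx (\row_(k < #|A|) (l 0 (enum_val k))^-1).
have NK : subm (diag_mx l) A *m L = 1%:M.
  rewrite subm_diag mulmx_diag; apply/matrixP => i j; rewrite !mxE.
  by rewrite mulfV // gt_eqF ?pos_def_diag.
rewrite /subm_quad.
have -> : invmx (subm (diag_mx l) A) = L.
  by rewrite -[LHS]mulmx1 -NK mulKmx.
rewrite innerC inner_diag [RHS]big_enum_val /=; apply: eq_bigr => i _.
have -> : subv h A i 0 = h (enum_val i) 0.
  rewrite mxE (bigD1 (enum_val i)) //= !mxE eqxx mul1r big1 ?addr0 // => a ai.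
  by rewrite !mxE (negbTE ai) mul0r.
by rewrite mxE mulrC.
Qed.

Lemma sum_minors_quad (R : realType) n (B Q : 'M[R]_n) (l : 'rV[R]_n) k
    (g : 'cV[R]_n) :
  Q *m Q^T = 1%:M -> B = Q *m diag_mx l *m Q^T -> pos_def B ->
  \sum_(A : {set 'I_n} | #|A| == k) \det (subm B A) * subm_quad B A g =
  \sum_(A : {set 'I_n} | #|A| == k)
     (\prod_(i in A) l 0 i) * \sum_(i in A) (Q^T *m g) i 0 ^+ 2 / l 0 i.
Proof.
move=> QQ BE pB; have pD : pos_def (diag_mx l).
  by apply: (pos_def_conj_diag QQ); rewrite -BE.
pose h := Q^T *m g.
have BgE : B + g *m g^T = Q *m (diag_mx l + h *m h^T) *m Q^T.
  rewrite mulmxDr mulmxDl -BE trmx_mul trmxK !mulmxA QQ mul1mx -!mulmxA QQ.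
  by rewrite mulmx1.
have := sum_minors_similar (diag_mx l + h *m h^T) k QQ.
rewrite -BgE; under eq_bigr do rewrite det_subm_rank1 //.
under [in RHS]eq_bigr do rewrite det_subm_rank1 //.
(* Invariance of the minors of [B] itself cancels the terms free of [g]. *)
rewrite !big_split /= BE sum_minors_similar // => /addrI ->.
by apply: eq_bigr => A _; rewrite det_subm_diag subm_quad_diag.
Qed.

(** * Elementary symmetric functions *)

(** Removing [j] is a bijection onto the sets of size [t] that avoid [j]; [Q] carries a further
    condition on the reduced set, later that it avoids a second point. *)
Lemma sum_prod_setU1 (R : comNzRingType) (I : finType) (l : I -> R) (j : I)
    (Q : pred {set I}) t :
  \sum_(A : {set I} | [&& j \in A, #|A| == t.+1 & Q (A :\ j)]) \prod_(a in A) l a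
  = l j * \sum_(A : {set I} | [&& j \notin A, #|A| == t & Q A])
            \prod_(a in A) l a.
Proof.
rewrite big_distrr /=.
rewrite (reindex_onto (fun A => j |: A) (fun A => A :\ j)) /=; last first.
  by move=> A /andP[jA _]; rewrite finset.setD1K.
have jAE (A : {set I}) : ((j |: A) :\ j == A) = (j \notin A).
  apply/eqP/idP => [<-|jA]; first by rewrite !inE eqxx.
  by rewrite finset.setU1K.
apply: eq_big => [A|A].
  rewrite jAE finset.setU11 /=; have [jA|jA] := boolP (j \in A).
    by rewrite andbF.
  by rewrite cardsU1 jA finset.setU1K // andbT.
by rewrite jAE => /andP[_ jA]; rewrite big_setU1.
Qed.

(* With t = tau - 1: split the sets A according to whether they contain [i].
   Those which do not all meet [D]; removing a point of [D] from them leaves a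
   set of size t which still avoids [i]. *)
Lemma elementary_sym_le (R : realFieldType) (I : finType) (l : I -> R) (i : I)
    (D : {set I}) t :
  (forall a, 0 < l a) -> i \notin D -> (#|~: (i |: D)| <= t)%N ->
  \sum_(A : {set I} | #|A| == t.+1) \prod_(a in A) l a <=
  (l i + \sum_(j in D) l j) / l i *
    \sum_(A : {set I} | (i \in A) && (#|A| == t.+1)) \prod_(a in A) l a.
Proof.
move=> l0 iD cD.
have P0 (A : {set I}) : 0 <= \prod_(a in A) l a.
  by apply: prodr_ge0 => a _; exact: ltW.
pose E := \sum_(A : {set I} | (i \notin A) && (#|A| == t)) \prod_(a in A) l a.
have iE : \sum_(A : {set I} | (i \in A) && (#|A| == t.+1)) \prod_(a in A) l a
    = l i * E.
  have := sum_prod_setU1 l i predT t.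
  under eq_bigl do rewrite andbT.
  by under [in RHS]eq_bigl do rewrite andbT.
rewrite iE mulrA divfK ?gt_eqF // mulrDl (bigID (fun A : {set I} => i \in A)) /=.
rewrite (eq_bigl (fun A : {set I} => (i \in A) && (#|A| == t.+1))); last first.
  by move=> A; rewrite andbC.
rewrite iE lerD2l.
apply: (@le_trans _ _ (\sum_(A : {set I} | (#|A| == t.+1) && (i \notin A))
    \sum_(j in D | j \in A) \prod_(a in A) l a)).
  apply: ler_sum => A /andP[/eqP cA iA].
  (* A set avoiding both [i] and [D] would have at most [t] elements. *)
  have /finset.set0Pn[j] : A :&: D != finset.set0.
    apply: contraTneq cD => AD; rewrite -ltnNge -cA subset_leq_card //.
    apply/fintype.subsetP => a aA; rewrite !inE negb_or; apply/andP; split.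
      by apply: contraNneq iA => <-.
    by apply/negP => aD; have := finset.in_set0 a; rewrite -AD inE aA aD.
  rewrite inE => /andP[jA jD].
  by rewrite [leRHS](bigD1 j) ?jD //= lerDl sumr_ge0.
rewrite (exchange_big_dep (mem D)) => [/=|A j _ /andP[]//].
rewrite mulr_suml; apply: ler_sum => j jD.
rewrite (eq_bigl (fun A : {set I} => [&& j \in A, #|A| == t.+1 & i \notin A :\ j])).
  rewrite (sum_prod_setU1 l j (fun A => i \notin A)) ler_pM2l //.
  rewrite big_mkcond [leRHS]big_mkcond; apply: ler_sum => A _.
  by case: (j \in A); case: (#|A| == t); case: (i \in A) => //=; rewrite ?P0.
move=> A; rewrite jD !inE.
have -> : (i == j) = false by apply: contraNF iD => /eqP->.
by case: (j \in A); case: (i \in A); case: (#|A| == _).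
Qed.

(** * Eigenvalues of the coordinate approximation *)

Lemma card_ord_lt n s : (#|[set j : 'I_n | (j < s)%N]%SET| <= s)%N.
Proof.
rewrite cardE -(size_map val) -[leqRHS](size_iota 0) uniq_leq_size //.
  by rewrite map_inj_uniq ?enum_uniq //; exact: val_inj.
by move=> a /mapP[j]; rewrite mem_enum inE => js ->; rewrite mem_iota.
Qed.

(* The eigenvalues of the [t.+1]-coordinate approximation, with 0-based indices:
   for [t < n] the last sum is the single term [l 0 t]. *)
Definition coord_eig (R : realType) n (l : 'rV[R]_n) (t : nat) (i : 'I_n) : R :=
  \sum_(j < n | (t < j)%N) l 0 j + (if (i <= t)%N then l 0 i else
     \sum_(j < n | j == t :> nat) l 0 j).

(** Chosen so that [coord_eig l t i] is [l 0 i] plus the sum over this set, the form required by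
    [elementary_sym_le]. For [i > t] the first sum in [coord_eig] already contains [l 0 i], and the
    index [t] joins the tail. *)
Definition coord_tail n (t : nat) (i : 'I_n) : {set 'I_n} :=
  [set j : 'I_n | (j != i) && (if (i <= t)%N then (t < j)%N else (t <= j)%N)].

Lemma coord_eigE (R : realType) n (l : 'rV[R]_n) t (i : 'I_n) :
  coord_eig l t i = l 0 i + \sum_(j in coord_tail t i) l 0 j.
Proof.
rewrite /coord_eig; case: ifP => it.
  rewrite addrC; congr (_ + _); apply: eq_bigl => j; rewrite inE it.
  by rewrite andb_idl // => tj; apply: contraTneq tj => ->; rewrite -leqNgt.
have -> : l 0 i + \sum_(j in coord_tail t i) l 0 j =
    \sum_(j < n | (t <= j)%N) l 0 j.
  rewrite [RHS](bigD1 i) /=; last by rewrite ltnW // ltnNge it.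
  by congr (_ + _); apply: eq_bigl => j; rewrite inE it andbC.
rewrite addrC [RHS](bigID (fun j : 'I_n => j == t :> nat)) /=.
by congr (_ + _); apply: eq_bigl => j; lia.
Qed.

Lemma coord_eig_ge (R : realType) n (l : 'rV[R]_n) t (i : 'I_n) :
  (forall a, 0 < l 0 a) -> l 0 i <= coord_eig l t i.
Proof. by move=> l0; rewrite coord_eigE lerDl sumr_ge0 // => j _; exact: ltW. Qed.

(** What remains are the indices up to [t] other than [i], or those below [t]; only a bound, since
    [t] may exceed [n]. *)
Lemma card_coord_tail n t (i : 'I_n) : (#|~: (i |: coord_tail t i)| <= t)%N.
Proof.
case: (leqP i t) => it; last first.
  apply: leq_trans (card_ord_lt n t); apply/subset_leq_card/fintype.subsetP => j.
  by rewrite !inE leqNgt it /=; case: (eqVneq j i) => //= _; rewrite -ltnNge.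
have := card_ord_lt n t.+1; rewrite (cardsD1 i) inE ltnS it add1n ltnS.
apply: leq_trans; apply/subset_leq_card/fintype.subsetP => j.
by rewrite !inE it; case: (eqVneq j i) => //= _; rewrite -leqNgt.
Qed.

(** After exchanging sums, both sides are combinations of the squared entries of [Q^T g];
    [elementary_sym_le] with [D := coord_tail t i] compares the coefficients one by one. *)
Lemma sum_minors_quad_ge (R : realType) n (B Q : 'M[R]_n) (l : 'rV[R]_n) t
    (g : 'cV[R]_n) :
  Q *m Q^T = 1%:M -> B = Q *m diag_mx l *m Q^T -> pos_def B ->
  (\sum_(A : {set 'I_n} | #|A| == t.+1) \det (subm B A)) *
    (\sum_i (Q^T *m g) i 0 ^+ 2 / coord_eig l t i) <=
  \sum_(A : {set 'I_n} | #|A| == t.+1) \det (subm B A) * subm_quad B A g.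
Proof.
move=> QQ BE pB; rewrite (sum_minors_quad _ _ QQ BE pB).
have l0 i : 0 < l 0 i.
  by apply/pos_def_diag/(pos_def_conj_diag QQ); rewrite -BE.
rewrite BE sum_minors_similar //; under eq_bigr do rewrite det_subm_diag.
rewrite mulr_sumr.
under [leRHS]eq_bigr do rewrite mulr_sumr.
rewrite (exchange_big_dep predT) //=; apply: ler_sum => i _.
rewrite -mulr_suml; set hh := _ ^+ 2; have hh0 : 0 <= hh by rewrite sqr_ge0.
have b0 : 0 < coord_eig l t i by rewrite (lt_le_trans (l0 i)) // coord_eig_ge.
have ie : i \notin coord_tail t i by rewrite inE eqxx.
have := elementary_sym_le l0 ie (card_coord_tail t i).
rewrite -coord_eigE => /(ler_wpM2r (divr_ge0 hh0 (ltW b0)))/le_trans; apply.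
rewrite le_eqVlt; apply/orP; left; apply/eqP.
rewrite (eq_bigl (fun A : {set 'I_n} => (#|A| == t.+1) && (i \in A))); last first.
  by move=> A; rewrite andbC.
by field; rewrite !gt_eqF.
Qed.

Lemma coord_approx_diag (R : realType) n (B C : 'M[R]_n) t :
  (t < n)%N -> coord_approx B t.+1 C ->
  exists (Q : 'M[R]_n) (l : 'rV[R]_n),
    [/\ Q *m Q^T = 1%:M, B = Q *m diag_mx l *m Q^T
      & C = Q *m diag_mx (\row_i coord_eig l t i) *m Q^T].
Proof.
move=> tn [_ [Q [lam [QQ _ BE ->]]]].
exists Q, (\row_i lam`_i); split=> //.
set c := \sum_(_ <= _ < _) _.
rewrite -[c%:M]mul1mx -QQ -[_ *m c%:M]mulmxA scalar_mxC mulmxA.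
rewrite -mulmxDl -mulmxDr -diag_const_mx -raddfD; congr (_ *m diag_mx _ *m _).
apply/rowP => i; rewrite !mxE addrC /coord_eig; congr (_ + _).
  rewrite /c big_geq_mkord; apply: eq_bigr => j _.
  by rewrite mxE.
case: leqP => it; first by rewrite mxE.
(* Since [t < n], exactly one index equals [t], and it carries lambda_tau. *)
rewrite (big_pred1 (Ordinal tn)) ?mxE // => j.
Qed.

(** * Consequences of smoothness and strong convexity *)

Lemma sqr_normB (R : realType) n (B : 'M[R]_n) (v : 'cV[R]_n) :
  0 <= inner (B *m v) v -> normB B v ^+ 2 = inner (B *m v) v.
Proof. exact: sqr_sqrtr. Qed.

Lemma inner_conj_diag (R : realType) n (Q : 'M[R]_n) (b : 'rV[R]_n)
    (v : 'cV[R]_n) :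
  inner (Q *m diag_mx b *m Q^T *m v) v = \sum_i b 0 i * (Q^T *m v) i 0 ^+ 2.
Proof. by rewrite -!mulmxA inner_mulmxl inner_diag. Qed.

Lemma sqr_normB_conj_diag (R : realType) n (Q : 'M[R]_n) (b : 'rV[R]_n)
    (v : 'cV[R]_n) :
  (forall i, 0 <= b 0 i) ->
  normB (Q *m diag_mx b *m Q^T) v ^+ 2 =
  \sum_i b 0 i * (Q^T *m v) i 0 ^+ 2.
Proof.
move=> b0; rewrite sqr_normB inner_conj_diag //.
by apply: sumr_ge0 => i _; rewrite mulr_ge0 ?sqr_ge0.
Qed.

Lemma inner_orthogonal (R : realType) n (Q : 'M[R]_n) (u v : 'cV[R]_n) :
  Q *m Q^T = 1%:M -> inner (Q^T *m u) (Q^T *m v) = inner u v.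
Proof. by move=> QQ; rewrite inner_mulmxl trmxK mulmxA QQ mul1mx. Qed.

(** The step is [- w], and [subm B A *m u = subv g A] makes [inner g w] and [inner (B *m w) w] both
    equal to [q]; smoothness then yields [- q + q / 2]. *)
Lemma rcd_step_le (R : realType) n (f : 'cV[R]_n -> R) (B : 'M[R]_n)
    (A : {set 'I_n}) (x : 'cV[R]_n) :
  pos_def B -> one_smooth f B ->
  f (rcd_step f B A x) <= f x - 2^-1 * subm_quad B A (grad f x).
Proof.
move=> pB [_ smooth]; apply: le_trans (smooth x _) _.
have uN := pos_def_unitmx (pos_def_subm A pB).
set g := grad f x; set q := subm_quad _ _ _.
pose u := invmx (subm B A) *m subv g A; pose w := colsel R A *m u.
have -> : rcd_step f B A x - x = - w.
  by rewrite /rcd_step addrAC subrr add0r -mulmxA.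
have gw : inner g w = q by rewrite innerC inner_mulmxl innerC.
have ww : inner (B *m w) w = q.
  rewrite innerC {1}/w inner_mulmxl.
  have -> : (colsel R A)^T *m (B *m w) = subm B A *m u by rewrite /subm !mulmxA.
  by rewrite /u mulKVmx // innerC.
have q0 : 0 <= q.
  rewrite -ww; have [->|w0] := eqVneq w 0; last exact/ltW/(pB.2).
  by rewrite mulmx0 innerE mulmx0 mxE.
have wwN : inner (B *m - w) (- w) = q.
  by rewrite -ww !innerE !mulmxN linearN /= mulNmx opprK.
have gwN : inner g (- w) = - q by rewrite -gw !innerE mulmxN mxE.
by rewrite sqr_normB wwN ?gwN //; lra.
Qed.

(** In the eigenbasis [Q] the bound separates into one-variable quadratics, each handled by
    completing the square. *)
Lemma strongly_convex_lower (R : realType) n (f : 'cV[R]_n -> R) (Q : 'M[R]_n)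
    (b : 'rV[R]_n) mu (x y : 'cV[R]_n) :
  Q *m Q^T = 1%:M -> (forall i, 0 < b 0 i) ->
  strongly_convex f (Q *m diag_mx b *m Q^T) mu ->
  f x - (2 * mu)^-1 * \sum_i (Q^T *m grad f x) i 0 ^+ 2 / b 0 i <= f y.
Proof.
move=> QQ b0 [mu0 _ conv]; apply: le_trans (conv x y).
rewrite sqr_normB_conj_diag => [|i]; last exact: ltW.
rewrite -(inner_orthogonal _ _ QQ) -addrA lerD2l !mulr_sumr -sumrN -big_split.
apply: ler_sum => i _ /=; set h := (_ *m grad f x) i 0.
set z := (_ *m (_ - _)) i 0.
rewrite -subr_ge0.
have -> : h * z + mu / 2 * (b 0 i * z ^+ 2) - - ((2 * mu)^-1 * (h ^+ 2 / b 0 i))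
    = (mu * b 0 i * z + h) ^+ 2 / (2 * mu * b 0 i).
  by field; rewrite !gt_eqF.
by rewrite divr_ge0 ?sqr_ge0 // !mulr_ge0 // ltW.
Qed.

(** Between 0 and the [i]-th eigenvector the two bounds give [mu b_i <= l_i <= b_i]. Nonnegativity
    of [1 - mu] lets the contraction be iterated. *)
Lemma modulus_le1 (R : realType) n (f : 'cV[R]_n -> R) (Q : 'M[R]_n)
    (l b : 'rV[R]_n) mu (i : 'I_n) :
  Q *m Q^T = 1%:M -> (forall j, 0 < l 0 j <= b 0 j) ->
  one_smooth f (Q *m diag_mx l *m Q^T) ->
  strongly_convex f (Q *m diag_mx b *m Q^T) mu -> mu <= 1.
Proof.
move=> QQ lb [_ smooth] [mu0 _ conv]; have QQ' := mulmx1C QQ.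
pose v : 'cV[R]_n := Q *m delta_mx i 0.
have := le_trans (conv 0 v) (smooth 0 v).
have l0 j : 0 <= l 0 j by case/andP: (lb j) => /ltW.
have b0 j : 0 <= b 0 j by case/andP: (lb j) => _; exact: le_trans.
rewrite subr0 !sqr_normB_conj_diag //.
have single (c : 'rV[R]_n) : \sum_j c 0 j * (Q^T *m v) j 0 ^+ 2 = c 0 i.
  rewrite /v mulmxA QQ' mul1mx (bigD1 i) //= big1 => [|j /negbTE ji].
    by rewrite mxE !eqxx expr1n mulr1 addr0.
  by rewrite mxE ji expr0n mulr0.
rewrite !single; have /andP[li0 lbi] := lb i => le.
have bi0 := lt_le_trans li0 lbi.
have : mu * b 0 i <= 1 * b 0 i by lra.
by rewrite ler_pM2r.
Qed.

(** * Existence of a minimizer *)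

(** Carries [f], defined on columns, to rows, where [rV_compact] gives compact boxes. *)
Lemma trmx_continuous (R : realType) m n :
  continuous (fun M : 'M[R]_(m, n) => M^T).
Proof.
move=> M s /nbhs_ballP[e e0 es]; apply/nbhs_ballP; exists e => // N [_ MN].
by apply: es; split=> // i j; rewrite !mxE.
Qed.

(** Outside a large box the lower bound exceeds [f 0], so a minimizer over the compact box is
    global. *)
Lemma quadratic_growth_min (R : realType) n (f : 'cV[R]_n -> R) (g : 'I_n -> R)
    (c : R) :
  0 < c -> continuous f ->
  (forall y : 'cV[R]_n, f 0 + \sum_i (g i * y i 0 + c * y i 0 ^+ 2) <= f y) ->
  exists xmin, forall y, f xmin <= f y.
Proof.
move=> c0 fcont fge.
pose G := \sum_i g i ^+ 2 / (4 * c).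
have g0 i : 0 <= g i ^+ 2 / (4 * c).
  by rewrite divr_ge0 ?sqr_ge0 // mulr_ge0 // ltW.
have G0 : 0 <= G by apply: sumr_ge0.
pose N := \sum_i `|g i|.
have N0 : 0 <= N by apply: sumr_ge0.
(* If [|y_i| > M], then [c |y_i| - |g_i| >= 1 + G] and [|y_i| >= 1], so coordinate [i] alone
   outweighs the loss of at most [G] from the others. *)
pose M := (N + 1 + G) / c + 1.
have M1 : 1 <= M by rewrite lerDr divr_ge0 ?(ltW c0) // !addr_ge0.
pose box := [set v : 'rV[R]_n | forall i, `[- M, M]%classic (v ord0 i)].
have boxP : compact box.
  by apply: (@rV_compact _ _ (fun=> `[- M, M]%classic)) => i;
     exact: segment_compact.
have box0 : box 0 by move=> i; rewrite /= mxE in_itv /=; apply/andP; split; lra.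
have cphi : {within box, continuous (fun v : 'rV[R]_n => f v^T)}.
  apply: continuous_subspaceT => v.
  by apply: continuous_comp; [exact: trmx_continuous|exact: fcont].
have [v vbox vmin] := compact_EVT_min (ex_intro _ 0 box0) boxP cphi.
exists v^T => y; have [ybox|ybox] := pselect (box y^T).
  by rewrite -[y]trmxK; apply: vmin; rewrite inE.
have {}vmin : f v^T <= f 0.
  by rewrite -[X in _ <= f X]trmx0; apply: vmin; rewrite inE.
apply: le_trans vmin (le_trans _ (fge y)); rewrite lerDl.
have [i yi] : exists i, M < `|y i 0|.
  apply: contrapT => /forallNP h; apply: ybox => i.
  rewrite /= mxE in_itv /= -ler_norml.
  by rewrite leNgt; apply/negP/h.
have term j : - (g j ^+ 2 / (4 * c)) <= g j * y j 0 + c * y j 0 ^+ 2.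
  rewrite -subr_ge0.
  have -> : g j * y j 0 + c * y j 0 ^+ 2 - - (g j ^+ 2 / (4 * c))
    = (2 * c * y j 0 + g j) ^+ 2 / (4 * c) by field; rewrite gt_eqF.
  by rewrite divr_ge0 ?sqr_ge0 // mulr_ge0 // ltW.
rewrite (bigD1 i) //=.
have rest : - G <= \sum_(j < n | j != i) (g j * y j 0 + c * y j 0 ^+ 2).
  apply: (@le_trans _ _ (\sum_(j < n | j != i) - (g j ^+ 2 / (4 * c)))).
    by rewrite sumrN lerN2 /G [leRHS](bigD1 i) //= lerDr.
  exact: ler_sum.
have gN : `|g i| <= N by rewrite /N (bigD1 i) //= lerDl sumr_ge0.
have cM : N + 1 + G <= c * `|y i 0|.
  by rewrite mulrC -ler_pdivrMr // (le_trans _ (ltW yi)) // lerDl.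
have gy : - (`|g i| * `|y i 0|) <= g i * y i 0 by rewrite -normrM lerNnormlW.
have y1 : 1 <= `|y i 0| by rewrite (le_trans M1) // ltW.
have : (1 + G) * 1 <= (c * `|y i 0| - `|g i|) * `|y i 0|.
  by apply: ler_pM => //; lra.
rewrite mulrBl -mulrA -expr2 real_normK ?num_real //; lra.
Qed.

Lemma strongly_convex_min (R : realType) n (f : 'cV[R]_n -> R) (Q : 'M[R]_n)
    (b : 'rV[R]_n) mu :
  Q *m Q^T = 1%:M -> (forall i, 0 < b 0 i) ->
  strongly_convex f (Q *m diag_mx b *m Q^T) mu ->
  exists xmin, forall y, f xmin <= f y.
Proof.
move=> QQ b0 [mu0 df conv].
(* [1 / s] is a positive lower bound of all [b 0 i], also when [n = 0]. *)
pose s := 1 + \sum_i (b 0 i)^-1.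
have s0 : 0 < s by rewrite ltr_wpDr // sumr_ge0 // => i _; rewrite invr_ge0 ltW.
have sb i : s^-1 <= b 0 i.
  rewrite -[leRHS]invrK lef_pV2 ?posrE ?invr_gt0 // /s (bigD1 i) //= addrCA lerDl.
  by rewrite addr_ge0 // sumr_ge0 // => j _; rewrite invr_ge0 ltW.
apply: (@quadratic_growth_min _ _ _ (fun i => grad f 0 i 0) (mu / 2 / s)).
- by rewrite !divr_gt0.
- by move=> x; exact: differentiable_continuous.
move=> y; apply: le_trans (conv 0 y); rewrite subr0.
rewrite sqr_normB_conj_diag => [|i]; last exact: ltW.
rewrite -addrA lerD2l big_split /= lerD2l -mulr_sumr -mulrA ler_pM2l ?divr_gt0 //.
have -> : \sum_i y i 0 ^+ 2 = \sum_i (Q^T *m y) i 0 ^+ 2.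
  exact: esym (inner_orthogonal y y QQ).
rewrite mulr_sumr; apply: ler_sum => i _.
by rewrite ler_wpM2r ?sqr_ge0.
Qed.

(** * Expectations of finitely valued random variables *)

(** The variable is a finite combination of indicators of the fibres of [U]. As iterates depend on
    finitely many sampled sets, all expectations become finite sums. *)
Lemma expectation_finite d (T : measurableType d) (R : realType)
    (P : probability T R) (X : finType) (U : T -> X) (phi : X -> R) :
  discrete_rv U ->
  ('E_P[(fun w => phi (U w))] =
   (\sum_a phi a * fine (P (U @^-1` [set a])))%:E)%E.
Proof.
move=> mU.
have Lind a : \1_(U @^-1` [set a]) \in Lfun P 1.
  by apply/Lfun1_integrable; exact: integrable_indic.
have -> : (fun w => phi (U w)) =
    \sum_(g <- [seq phi a \o* \1_(U @^-1` [set a]) | a <- index_enum X]) g.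
  apply/funext => w; rewrite big_map fct_sumE (bigD1 (U w)) //= big1 => [|a aU].
    by rewrite addr0 indicE mem_set //= mul1r.
  by rewrite indicE memNset ?mul0r // => /esym/eqP; rewrite (negbTE aU).
rewrite expectation_sum => [|g /mapP[a _ ->]]; last exact: Lfun_scale.
rewrite big_map -sumEFin; apply: eq_bigr => a _.
by rewrite expectationZl // expectation_indic // EFinM fineK // fin_num_measure.
Qed.

Lemma sum_fine_discrete d (T : measurableType d) (R : realType)
    (P : probability T R) (X : finType) (U : T -> X) :
  discrete_rv U -> \sum_a fine (P (U @^-1` [set a])) = 1.
Proof.
move=> mU; have := expectation_finite P (fun=> 1) mU.
rewrite (expectation_cst P 1) => -[->].
by apply: eq_bigr => a _; rewrite mul1r.
Qed.

Lemma discrete_rv_pair d (T : measurableType d) (X Y : finType) (U : T -> X)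
    (V : T -> Y) :
  discrete_rv U -> discrete_rv V -> discrete_rv (fun w => (U w, V w)).
Proof.
move=> mU mV [a b].
have -> : (fun w => (U w, V w)) @^-1` [set (a, b)] =
    U @^-1` [set a] `&` V @^-1` [set b].
  by apply/seteqP; split=> w /= => [[]|[-> ->]].
exact: measurableI.
Qed.

Lemma discrete_rv_ffun d (T : measurableType d) (X : finType) k
    (S : nat -> T -> X) :
  (forall i, (i < k)%N -> discrete_rv (S i)) ->
  discrete_rv (fun w => [ffun i : 'I_k => S i w]).
Proof.
move=> mS h.
have -> : (fun w => [ffun i : 'I_k => S i w]) @^-1` [set h] =
    \bigcap_(i in [set: 'I_k]) (S i @^-1` [set h i]).
  apply/seteqP; split=> w /= => [<- i _|Sh]; first by rewrite /= ffunE.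
  by apply/ffunP => i; rewrite ffunE; exact: Sh.
by apply: fin_bigcap_measurable => // i _; exact: mS.
Qed.

(** * Contraction in expectation *)

(** One step from a fixed point [x], with [p] the law of the sampled set: the mean decrease is at
    least [s / 2], which dominates [mu * (f x - f xmin)]. *)
Lemma rcd_mean_step_le (R : realType) n (f : 'cV[R]_n -> R) (B Q : 'M[R]_n)
    (l : 'rV[R]_n) t mu (p : {set 'I_n} -> R) (x xmin : 'cV[R]_n) :
  Q *m Q^T = 1%:M -> B = Q *m diag_mx l *m Q^T -> pos_def B ->
  one_smooth f B ->
  strongly_convex f (Q *m diag_mx (\row_i coord_eig l t i) *m Q^T) mu ->
  (forall A, 0 <= p A) -> \sum_A p A = 1 ->
  (forall A, p A = if #|A| == t.+1 then vol_mass B t.+1 A else 0) ->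
  \sum_A p A * f (rcd_step f B A x) - f xmin <= (1 - mu) * (f x - f xmin).
Proof.
move=> QQ BE pB smooth conv p0 p1 pE.
have l0 i : 0 < l 0 i.
  by apply/pos_def_diag/(pos_def_conj_diag QQ); rewrite -BE.
pose e := \sum_(A : {set 'I_n} | #|A| == t.+1) \det (subm B A).
have e0 : 0 < e.
  rewrite lt_def; apply/andP; split; last first.
    rewrite /e BE sum_minors_similar //; apply: sumr_ge0 => A _.
    by rewrite det_subm_diag prodr_ge0 // => i _; exact: ltW.
  (* Division by 0 gives 0, so [e = 0] would make all weights vanish, against total mass 1. *)
  apply: contra_eq_neq p1 => e0; rewrite big1 1?eq_sym ?oner_eq0 // => A _.
  by rewrite pE; case: ifP => // _; rewrite /vol_mass -/e e0 invr0 mulr0.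
pose s := \sum_i (Q^T *m grad f x) i 0 ^+ 2 / coord_eig l t i.
have b0 i : 0 < (\row_i coord_eig l t i) 0 i.
  by rewrite mxE (lt_le_trans (l0 i)) // coord_eig_ge.
have [mu0 _ _] := conv.
(* A Polyak-Lojasiewicz inequality in the norm dual to that of the coordinate approximation. *)
have gap : mu * (f x - f xmin) <= 2^-1 * s.
  have := strongly_convex_lower x xmin QQ b0 conv.
  under eq_bigr do rewrite [X in _ / X]mxE.
  rewrite -/s => le.
  have -> : 2^-1 * s = mu * ((2 * mu)^-1 * s) by field; rewrite gt_eqF.
  by rewrite ler_pM2l //; lra.
have quad : s <= \sum_A p A * subm_quad B A (grad f x).
  have := sum_minors_quad_ge t (grad f x) QQ BE pB.
  rewrite -/e mulrC -ler_pdivlMr // => /le_trans.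
  apply; rewrite mulr_suml le_eqVlt; apply/orP; left; apply/eqP.
  rewrite big_mkcond; apply: eq_bigr => A _; rewrite pE.
  by case: ifP => _; rewrite ?mul0r // /vol_mass -/e mulrAC.
have : \sum_A p A * f (rcd_step f B A x) <=
    \sum_A p A * (f x - 2^-1 * subm_quad B A (grad f x)).
  by apply: ler_sum => A _; rewrite ler_wpM2l // rcd_step_le.
under [leRHS]eq_bigr do rewrite mulrBr mulrCA.
rewrite sumrB -mulr_suml p1 mul1r -mulr_sumr; lra.
Qed.

(** By independence the pair [(S, H)] has a product law, so the one-step estimate holds for each
    value of the history and is averaged over the law of [H]. *)
Lemma rcd_expected_step (R : realType) n (f : 'cV[R]_n -> R) (B Q : 'M[R]_n)
    (l : 'rV[R]_n) t mu (xmin : 'cV[R]_n)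
    d (T : measurableType d) (P : probability T R) (X : finType)
    (S : T -> {set 'I_n}) (H : T -> X) (phi : X -> 'cV[R]_n) :
  Q *m Q^T = 1%:M -> B = Q *m diag_mx l *m Q^T -> pos_def B ->
  one_smooth f B ->
  strongly_convex f (Q *m diag_mx (\row_i coord_eig l t i) *m Q^T) mu ->
  volume_sampled P B t.+1 S -> discrete_rv H -> independent_rv P S H ->
  ('E_P[(fun w => f (rcd_step f B (S w) (phi (H w))))] - (f xmin)%:E <=
   (1 - mu)%:E * ('E_P[(fun w => f (phi (H w)))] - (f xmin)%:E))%E.
Proof.
move=> QQ BE pB smooth conv [mS cS PS] mH indep.
pose p A := fine (P (S @^-1` [set A])).
pose q h := fine (P (H @^-1` [set h])).
have p0 A : 0 <= p A by rewrite fine_ge0.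
have q0 h : 0 <= q h by rewrite fine_ge0.
have p1 : \sum_A p A = 1 by exact: sum_fine_discrete.
have q1 : \sum_h q h = 1 by exact: sum_fine_discrete.
have pE A : p A = if #|A| == t.+1 then vol_mass B t.+1 A else 0.
  rewrite /p; case: ifP => [/eqP cA|cA]; first by rewrite PS.
  rewrite (_ : S @^-1` _ = set0) ?measure0 // -subset0 => w /= Sw.
  by rewrite -Sw cS eqxx in cA.
have pqE A h : fine (P ((fun w => (S w, H w)) @^-1` [set (A, h)])) = p A * q h.
  rewrite /p /q -fineM ?fin_num_measure // -indep; congr (fine (P _)).
  by apply/seteqP; split=> w /= => [[]|[-> ->]].
rewrite (expectation_finite P (fun h => f (phi h)) mH).
rewrite (expectation_finite P (fun Ah => f (rcd_step f B Ah.1 (phi Ah.2)))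
  (discrete_rv_pair mS mH)).
rewrite -!EFinB -EFinM lee_fin.
rewrite (eq_bigr (fun Ah => q Ah.2 *
    (p Ah.1 * f (rcd_step f B Ah.1 (phi Ah.2))))); last first.
  by move=> [A h] _; rewrite pqE /=; ring.
rewrite -(pair_bigA _ (fun A h => q h * (p A * f (rcd_step f B A (phi h))))) /=.
rewrite exchange_big /=.
have -> : f xmin = \sum_h q h * f xmin by rewrite -mulr_suml q1 mul1r.
rewrite -!sumrB mulr_sumr; apply: ler_sum => h _.
rewrite -mulr_sumr -/(q h) [f _ * q h]mulrC -!mulrBr mulrCA ler_wpM2l //.
exact: (rcd_mean_step_le _ _ QQ BE pB smooth conv p0 p1 pE).
Qed.

Theorem theorem3p10 (R : realType) (n : nat) (f : 'cV[R]_n -> R)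
    (B : 'M[R]_n) (tau : nat) (Btau : 'M[R]_n) (mu : R)
    (hB : pos_def B) (hf : one_smooth f B)
    (htau : (1 <= tau <= n)%N)
    (hBtau : coord_approx B tau Btau)
    (hmu : strong_convexity_modulus f Btau mu)
    (x0 : 'cV[R]_n) (K : nat) (hK : (1 <= K)%N)
    (d : measure_display) (T : measurableType d) (P : probability T R)
    (S : nat -> T -> {set 'I_n}) (x : nat -> T -> 'cV[R]_n)
    (hx : RCDVS P f B tau x0 K S x) :
  exists2 xmin : 'cV[R]_n,
    forall y, f xmin <= f y &
    forall k, (k <= K)%N ->
      ('E_P[(fun w => f (x k w))] - (f xmin)%:E
        <= ((1 - mu) ^+ k * (f x0 - f xmin))%:E)%E.
Proof.
(* With [tau = t.+1], the 0-based index of lambda_tau is [t]. *)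
case: tau htau hBtau hx => // t /= tn hBtau [x0E hx].
have [Q [l [QQ BE CE]]] := coord_approx_diag tn hBtau.
have [conv _] := hmu; rewrite CE in conv.
have l0 i : 0 < l 0 i.
  by apply/pos_def_diag/(pos_def_conj_diag QQ); rewrite -BE.
have lb i : l 0 i <= (\row_i coord_eig l t i) 0 i by rewrite mxE coord_eig_ge.
have b0 i := lt_le_trans (l0 i) (lb i).
have mu1 : mu <= 1.
  apply: (modulus_le1 (l := l) (Ordinal tn) QQ _ _ conv) => [j|];
    last by rewrite -BE.
  by rewrite l0 lb.
have [xmin xminP] := strongly_convex_min QQ b0 conv.
exists xmin => //.
(* Each iterate is a function of the finite history of sampled sets, from which the next set is
   independent. *)
have history k : (k <= K)%N ->
    exists phi : {ffun 'I_k -> {set 'I_n}} -> 'cV[R]_n,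
    forall w, x k w = phi [ffun i : 'I_k => S i w].
  elim: k => [_|k IH kK]; first by exists (fun=> x0).
  have [phi phiE] := IH (ltnW kK); have [_ _ xS] := hx k kK.
  (* The last entry of [h] is the newest set; its first [k] entries form the previous history. *)
  exists (fun h => rcd_step f B (h ord_max)
    (phi [ffun i : 'I_k => h (widen_ord (leqnSn k) i)])) => w.
  rewrite xS phiE ffunE; congr (rcd_step _ _ _ (phi _)).
  by apply/ffunP => i; rewrite !ffunE.
elim=> [_|k IH kK].
  under [X in expectation P X]funext do rewrite x0E.
  by rewrite (expectation_cst P (f x0)) expr0 mul1r -EFinB.
have [phi phiE] := history k (ltnW kK); have [vS indep xS] := hx k kK.
have mH : discrete_rv (fun w => [ffun i : 'I_k => S i w]).
  by apply: discrete_rv_ffun => i ik; have [[]] := hx i (ltn_trans ik kK).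
have := rcd_expected_step xmin phi QQ BE hB hf conv vS mH indep.
have -> : (fun w => f (rcd_step f B (S k w) (phi [ffun i : 'I_k => S i w]))) =
    (fun w => f (x k.+1 w)) by apply/funext => w; rewrite xS phiE.
have -> : (fun w => f (phi [ffun i : 'I_k => S i w])) = (fun w => f (x k w)).
  by apply/funext => w; rewrite phiE.
move=> /le_trans; apply; rewrite exprS -mulrA [leRHS]EFinM.
by apply: lee_wpmul2l (IH (ltnW kK)); rewrite lee_fin subr_ge0.
Qed.
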